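(* Let $1\le k<d$, $t\ge0$, $n\ge1$, let $\nu_{k,d}$ be a probabilistic cubature for $\mathrm{Pol}_t(\mathcal{G}_{k,d})$, and let $P_1,\dots,P_n$ be independent random projections, each distributed according to $\nu_{k,d}$. Then for every $\tau>0$, $$\mathbb{P}\Big(\frac1{n^2}\sum_{i,j=1}^nK_t(P_i,P_j)-\lambda_t-\frac1n(k^t-\lambda_t)\ge\frac{\tau^2k^t}{n}\Big)\le4e^{-\Psi_\tau(n)}r_\tau(n),$$ where $$\Psi_\tau(n)=\frac{\tau^2/2}{(1-\lambda_t/k^t)+\frac{\tau}{3\sqrt n}},\qquad r_\tau(n)=1+\frac{6}{n\tau^2\ln^2\!\big(1+\frac{\tau}{\sqrt n(1-\lambda_t/k^t)}\big)}.$$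
   Context: $\mathscr{H}_d$ denotes the real symmetric $d\times d$ matrices with $\langle A,B\rangle=\operatorname{trace}(AB)$. $\mathcal{G}_{k,d}=\{P\in\mathscr{H}_d:P^2=P,\ \operatorname{trace}(P)=k\}$, with orthogonally invariant Borel probability measure $\sigma_{k,d}$. $\mathrm{Pol}_t(\mathcal{G}_{k,d})$ is the space of restrictions to $\mathcal{G}_{k,d}$ of polynomials of degree at most $t$ on $\mathscr{H}_d$. A Borel probability measure $\nu_{k,d}$ on $\mathcal{G}_{k,d}$ is a probabilistic cubature for $\mathrm{Pol}_t(\mathcal{G}_{k,d})$ if $\int f\,d\nu_{k,d}=\int f\,d\sigma_{k,d}$ for all $f\in\mathrm{Pol}_t(\mathcal{G}_{k,d})$. $K_t(P,Q)=\langle P,Q\rangle^t$ for $P,Q\in\mathcal{G}_{k,d}$, and $\lambda_t=\int_{\mathcal{G}_{k,d}}\int_{\mathcal{G}_{k,d}}K_t(P,Q)\,d\sigma_{k,d}(P)\,d\sigma_{k,d}(Q)$. *)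

(* Defs.v *)
From HB Require Import structures.
From mathcomp Require Import all_boot all_order all_algebra.
From mathcomp Require Import all_classical all_reals all_analysis.
From mathcomp Require mpoly.
Import numFieldNormedType.Exports.
Set Implicit Arguments. Unset Strict Implicit. Unset Printing Implicit Defensive.
Import Order.TTheory GRing.Theory Num.Theory.
Local Open Scope classical_set_scope.
Local Open Scope ring_scope.

Definition mxB (R : realType) (d : nat) := g_sigma_algebraType (open : set (set 'M[R]_d)).

Definition grass (R : realType) (k d : nat) : set (mxB R d) :=
  [set P : 'M[R]_d | P^T = P /\ P *m P = P /\ \tr P = k%:R].

Definition polyfun_le (R : realType) (d t : nat) (f : 'M[R]_d -> R) : Prop :=
  exists p : mpoly.mpoly (d * d) R,
    all (fun m => (mpoly.mdeg m <= t)%N) (mpoly.msupp p) /\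
    forall P : 'M[R]_d, f P = mpoly.meval (fun i => mxvec P 0 i) p.

Definition orth_invariant_grass_measure (R : realType) (k d : nat)
    (sigma : probability (mxB R d) R) : Prop :=
  sigma (@grass R k d) = 1%E /\
  forall U : 'M[R]_d, U *m U^T = 1%:M ->
    forall A : set (mxB R d), measurable A ->
      sigma ((fun P : mxB R d => U *m P *m U^T) @^-1` A) = sigma A.

Definition prob_cubature (R : realType) (k d t : nat)
    (sigma nu : probability (mxB R d) R) : Prop :=
  nu (@grass R k d) = 1%E /\
  forall f : 'M[R]_d -> R, polyfun_le t f ->
    (\int[nu]_(P in @grass R k d) (f P)%:E = \int[sigma]_(P in @grass R k d) (f P)%:E)%E.

Definition Kt (R : realType) (d t : nat) (P Q : 'M[R]_d) : R := (\tr (P *m Q)) ^+ t.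

Definition lambda_t (R : realType) (k d t : nat) (sigma : probability (mxB R d) R) : R :=
  fine (\int[sigma]_(P in @grass R k d)
          \int[sigma]_(Q in @grass R k d) (Kt t P Q)%:E)%E.

Definition mutually_independent (dO : measure_display) (O : measurableType dO)
    (R : realType) (PP : probability O R) (d n : nat) (X : 'I_n -> O -> mxB R d) : Prop :=
  forall A : 'I_n -> set (mxB R d), (forall i, measurable (A i)) ->
    PP (\bigcap_i (X i @^-1` A i)) = (\prod_(i < n) PP (X i @^-1` A i))%E.

Definition has_law (dO : measure_display) (O : measurableType dO)
    (R : realType) (PP : probability O R) (d : nat) (X : O -> mxB R d)
    (nu : probability (mxB R d) R) : Prop :=
  measurable_fun setT X /\
  forall A : set (mxB R d), measurable A -> PP (X @^-1` A) = nu A.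

Definition Psi (R : realType) (lam kt tau : R) (n : nat) : R :=
  (tau ^+ 2 / 2) / ((1 - lam / kt) + tau / (3 * Num.sqrt n%:R)).

Definition rfun (R : realType) (lam kt tau : R) (n : nat) : R :=
  1 + 6 / (n%:R * tau ^+ 2 *
           (ln (1 + tau / (Num.sqrt n%:R * (1 - lam / kt)))) ^+ 2).

(* Main.v *)
(* The entries of the t-fold tensor power of P embed the Grassmannian into a
   Euclidean space with K_t as inner product.  The mean mu of this embedding is
   the same under nu and sigma by the cubature property, and its inner product
   with every point is lambda_t, since orthogonal invariance and transitivity of
   the orthogonal group on projections of rank k make P |-> int K_t(P, Q) dsigma(Q)
   constant.  Hence the centred features xi_i are independent, have mean zero and
   squared norm k^t - lambda_t, and ||sum xi_i||^2 = sum K_t(P_i, P_j) - n^2 lambda_t.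
   Pinelis' argument for Hilbert-space valued sums then gives the bound
   2 exp(-Psi): pointwise,
     cosh |u + v| <= cosh |u| (exp |v| - |v|) + (sinh |u| / |u|) <u, v>,
   the linear term integrates to zero, so E cosh |S_n| <= (exp b - b)^n, and one
   concludes by Markov's inequality with Bernstein's choice of the exponent. *)
Require Import Defs.
From HB Require Import structures.
From mathcomp Require Import all_boot all_order all_algebra.
From mathcomp Require Import all_classical all_reals all_analysis.
From mathcomp Require Import measurable_realfun.
From mathcomp Require mpoly.
From mathcomp Require Import ring lra.
Set Implicit Arguments.
Unset Strict Implicit.
Unset Printing Implicit Defensive.
Import (canonicals,coercions) mpoly.
Import Order.TTheory GRing.Theory Num.Theory.
Import numFieldNormedType.Exports.
Local Open Scope classical_set_scope.
Local Open Scope ring_scope.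

(** Induction on the exponent: the two sides of the step differ by
    [p * q * (x - y) * (x ^+ m - y ^+ m)], whose last two factors have the same sign. *)
Lemma expr_mean_le (R : realDomainType) (p q x y : R) (m : nat) :
  0 <= p -> 0 <= q -> p + q = 1 -> 0 <= x -> 0 <= y ->
  (p * x + q * y) ^+ m <= p * x ^+ m + q * y ^+ m.
Proof.
move=> p0 q0 pq x0 y0; elim: m => [|m IH]; first by rewrite !expr0 !mulr1 pq.
have h0 : 0 <= p * x + q * y by rewrite addr_ge0// mulr_ge0.
rewrite exprS (le_trans (ler_wpM2l h0 IH))//.
have mono : 0 <= (x - y) * (x ^+ m - y ^+ m).
  have [xy|/ltW yx] := leP x y.
    by apply: mulr_le0; rewrite subr_le0 ?lerXn2r ?nnegrE.
  by apply: mulr_ge0; rewrite subr_ge0 ?lerXn2r ?nnegrE.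
have := mulr_ge0 (mulr_ge0 p0 q0) mono; rewrite !exprS.
have -> : q = 1 - p by rewrite -pq addrC addKr.
lra.
Qed.

(** * Hyperbolic functions and exponential inequalities *)

Section exponential_bounds.
Context {R : realType}.
Implicit Types x y z a b c u v p q : R.

Let cvg_expR x : series (exp_coeff x) @ \oo --> expR x.
Proof. exact: is_cvg_series_exp_coeff. Qed.

Let series_expE x n :
  series (exp_coeff x) n = \sum_(0 <= k < n) (k`!%:R)^-1 * x ^+ k.
Proof. by rewrite seriesEnat /= exp_coeffE. Qed.

Let big2 (f : nat -> R) n :
  \sum_(0 <= k < n.+2) f k = f 0%N + (f 1%N + \sum_(2 <= k < n.+2) f k).
Proof. by rewrite big_ltn// big_ltn. Qed.

Definition cosh x : R := (expR x + expR (- x)) / 2.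
Definition sinh x : R := (expR x - expR (- x)) / 2.

Lemma cosh_ge0 x : 0 <= cosh x.
Proof. by rewrite divr_ge0// addr_ge0// expR_ge0. Qed.

(** A power series in the square of the argument with nonnegative coefficients is convex and
    increasing in that square. The comparison is made on partial sums, where the odd terms
    cancel. *)
Lemma cosh_mean_le p q u v z : 0 <= p -> 0 <= q -> p + q = 1 ->
  z ^+ 2 <= p * u ^+ 2 + q * v ^+ 2 -> cosh z <= p * cosh u + q * cosh v.
Proof.
move=> p0 q0 pq zuv.
pose s x n := series (exp_coeff x) n + series (exp_coeff (- x)) n.
have cs x : s x @ \oo --> expR x + expR (- x) by exact: cvgD.
suff : expR z + expR (- z) <=
    p * (expR u + expR (- u)) + q * (expR v + expR (- v)) by rewrite /cosh; lra.
have cr : (fun n => p * s u n + q * s v n) @ \oo -->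
    p * (expR u + expR (- u)) + q * (expR v + expR (- v)).
  by apply: cvgD; apply: cvgMr => //; exact: cs.
apply: (ler_cvg_to (cs z) cr); apply: nearW => n.
rewrite /s !series_expE -!big_split/= !mulr_sumr -big_split/=.
apply: ler_sum => i _.
have [oi|ei] := boolP (odd i).
  by rewrite (exprNn z) (exprNn u) (exprNn v) -signr_odd oi expr1 !mulN1r !mulrN !subrr !mulr0 addr0.
rewrite (exprNn z) (exprNn u) (exprNn v) -signr_odd (negbTE ei) expr0 !mul1r.
rewrite -[i]odd_double_half (negbTE ei) add0n -mul2n !exprM.
have i0 : 0 <= ((2 * i./2)`!%:R : R)^-1 by rewrite invr_ge0.
have hz : (z ^+ 2) ^+ i./2 <= p * (u ^+ 2) ^+ i./2 + q * (v ^+ 2) ^+ i./2.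
  apply: le_trans (expr_mean_le _ p0 q0 pq (sqr_ge0 _) (sqr_ge0 _)).
  by rewrite lerXn2r ?nnegrE ?sqr_ge0// (le_trans (sqr_ge0 z)).
have := ler_wpM2l i0 hz; lra.
Qed.

Lemma cosh_le x y : 0 <= x -> x <= y -> cosh x <= cosh y.
Proof.
move=> x0 xy; have := @cosh_mean_le 1 0 y 0 x ler01 (lexx _).
rewrite addr0 !mul1r !mul0r !addr0; apply => //.
by rewrite lerXn2r ?nnegrE// (le_trans x0).
Qed.

Lemma le_sinh b : 0 <= b -> b <= sinh b.
Proof.
move=> b0; suff : b + b <= expR b - expR (- b) by rewrite /sinh; lra.
have cs : (fun n => series (exp_coeff b) n - series (exp_coeff (- b)) n) @ \oo -->
  expR b - expR (- b) by exact: cvgB.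
(* The shift by two keeps the terms of degree 0 and 1 in every partial sum; they contribute
   [b + b]. *)
rewrite -(cvg_shiftn 2) in cs.
apply: (ler_cvg_to (cvg_cst (b + b)) cs); apply: nearW => n /=.
rewrite !series_expE -sumrB addn2 big2.
rewrite !expr0 subrr add0r (_ : 1`!%:R = 1)// invr1 !mul1r !expr1 opprK lerDl.
apply: sumr_ge0 => i _; rewrite subr_ge0 ler_wpM2l ?invr_ge0// exprNn.
by rewrite -signr_odd; case: (odd i); rewrite ?expr1 ?expr0 ?mul1r// mulN1r
  lerNl (le_trans _ (exprn_ge0 _ b0))// oppr_le0 exprn_ge0.
Qed.

(** From degree 2 on, [y ^+ i <= y ^+ 2]. With [y] the square root of a variance ratio this extracts
    the variance factor in Bernstein's bound. *)
Lemma expR_remainder_scale x y : 0 <= x -> 0 <= y <= 1 ->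
  expR (x * y) - 1 - x * y <= y ^+ 2 * (expR x - 1 - x).
Proof.
move=> x0 /andP[y0 y1].
have c1 := @cvg_expR (x * y); rewrite -(cvg_shiftn 2) in c1.
have c2 := @cvg_expR x; rewrite -(cvg_shiftn 2) in c2.
have c3 : (fun n => series (exp_coeff (x * y)) (n + 2)%N - 1 - x * y) @ \oo -->
  expR (x * y) - 1 - x * y by apply: cvgB; [apply: cvgB|]; [exact: c1| |]; exact: cvg_cst.
have c4 : (fun n => y ^+ 2 * (series (exp_coeff x) (n + 2)%N - 1 - x)) @ \oo -->
  y ^+ 2 * (expR x - 1 - x).
  by apply: cvgMr; apply: cvgB; [apply: cvgB|]; [exact: c2| |]; exact: cvg_cst.
apply: (ler_cvg_to c3 c4); apply: nearW => n /=.
rewrite !series_expE addn2 !big2 !expr0 !expr1 !fact0 !invr1 !mul1r.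
rewrite ![1 + _]addrC !addrK ![_ + \sum_(_ <= _ < _) _]addrC !addrK.
rewrite mulr_sumr big_nat [leRHS]big_nat ler_sum// => i /andP[i2 _].
rewrite mulrCA ler_wpM2l ?invr_ge0// exprMn mulrC ler_wpM2r ?exprn_ge0//.
exact: ler_wiXn2l.
Qed.

(** Equivalent to [(1 - x / 3) * (expR x - 1 - x) <= x ^+ 2 / 2]. The right-hand side is the part of
    degree at most 2 of the series on the left, whose coefficient of degree k is (3 - k) / (3 k!),
    nonpositive for k at least 3. *)
Lemma expR_bernstein x : 0 <= x -> (1 - x / 3) * expR x <= 1 + 2 * x / 3 + x ^+ 2 / 6.
Proof.
move=> x0; have c1 := @cvg_expR x; rewrite -(cvg_shiftn 3) in c1.
have c2 := @cvg_expR x; rewrite -(cvg_shiftn 2) in c2.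
have c : (fun n => series (exp_coeff x) (n + 3)%N -
    x / 3 * series (exp_coeff x) (n + 2)%N) @ \oo --> expR x - x / 3 * expR x.
  by apply: cvgB; [exact: c1|apply: cvgMr; exact: c2].
rewrite mulrBl mul1r; apply: (ler_cvg_to c (cvg_cst _)); apply: nearW => n /=.
elim: n => [|n]; rewrite !(addn2, addn3) !series_expE.
  rewrite !big_nat_recr//= !big_geq// !expr0 !expr1 fact0.
  rewrite !factS fact0 !muln1 !invr1; lra.
rewrite [in X in _ -> X]big_nat_recr//= [in X in _ -> _ - _ * X <= _]big_nat_recr//=.
move=> IH.
suff : (n.+3)`!%:R^-1 * x ^+ n.+3 <= x / 3 * ((n.+2)`!%:R^-1 * x ^+ n.+2) by lra.
rewrite factS natrM invfM exprS.
have h0 : 0 <= (n.+2)`!%:R^-1 * x ^+ n.+2 * x.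
  by apply: mulr_ge0 => //; apply: mulr_ge0; [rewrite invr_ge0|exact: exprn_ge0].
rewrite (_ : _ * _ * _ = n.+3%:R^-1 * ((n.+2)`!%:R^-1 * x ^+ n.+2 * x)); last by ring.
rewrite (_ : x / 3 * _ = 3%:R^-1 * ((n.+2)`!%:R^-1 * x ^+ n.+2 * x)); last by ring.
by rewrite ler_wpM2r// lef_pV2 ?posrE ?ltr0n// ler_nat.
Qed.

(* By convexity of [cosh \o sqrt] it is enough to look at [c = a b] and
   [c = - a b], where [z] is [a + b] and [a - b]. *)
Lemma cosh_add_le a b c z : 0 <= a -> 0 <= b -> `|c| <= a * b ->
  z ^+ 2 <= a ^+ 2 + b ^+ 2 + 2 * c ->
  cosh z <= cosh a * (expR b - b) + sinh a / a * c.
Proof.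
move=> a0 b0 cab hz.
(* [e] plays the cosine of the angle between the vectors; if [a * b = 0] then [c = 0] and [e = 0]
   serves. *)
have [e [e1 ce]] : exists e, `|e| <= 1 /\ c = a * b * e.
  have [ab0|ab0] := eqVneq (a * b) 0.
    exists 0; rewrite normr0; split=> //; apply/eqP.
    by rewrite ab0 mul0r -normr_le0 -ab0.
  exists (c / (a * b)); split; last by rewrite mulrC divfK.
  by rewrite normrM normfV [`|a * b|]ger0_norm ?mulr_ge0// ler_pdivrMr ?mul1r//
    lt_neqAle eq_sym ab0 mulr_ge0.
move: e1; rewrite ler_norml => /andP[e1 e2].
have main : cosh z <= (1 + e) / 2 * cosh (a + b) + (1 - e) / 2 * cosh (a - b).
  apply: cosh_mean_le; [lra|lra|lra|].
  by rewrite (le_trans hz)// ce le_eqVlt; apply/orP; left; apply/eqP; field.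
(* At [a = 0] the quotient [sinh a / a] is 0 by convention, and the right-hand side vanishes too. *)
have lin : sinh a / a * c = e * b * sinh a.
  rewrite ce; have [->|an0] := eqVneq a 0; last by field.
  by rewrite /sinh oppr0 subrr !mul0r mulr0.
rewrite lin (le_trans main)//.
have sb := le_sinh b0; have sa := le_trans a0 (le_sinh a0).
have sc : sinh a <= cosh a by rewrite /sinh /cosh; have := expR_ge0 (- a); lra.
(* The subtracted product is nonnegative since [b <= sinh b] and [e * sinh a <= cosh a]. *)
suff -> : (1 + e) / 2 * cosh (a + b) + (1 - e) / 2 * cosh (a - b) =
   cosh a * (expR b - b) + e * b * sinh a - (sinh b - b) * (cosh a - e * sinh a).
  rewrite gerBl mulr_ge0 ?subr_ge0//.
  by rewrite (le_trans _ sc)// -[leRHS]mul1r ler_wpM2r.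
by rewrite /cosh /sinh !opprD opprK !expRD; field.
Qed.

End exponential_bounds.

(** * Transitivity of the orthogonal group on the Grassmannian *)

Lemma gram_row_eq0 (R : realDomainType) (d : nat) (v : 'rV[R]_d) :
  ((v *m v^T) 0 0 == 0) = (v == 0).
Proof.
apply/eqP/eqP => [|->]; last by rewrite mul0mx mxE.
rewrite mxE => /eqP; rewrite psumr_eq0 => [|j _]; last by rewrite mxE -expr2 sqr_ge0.
move=> /allP v0; apply/rowP => j; rewrite [RHS]mxE.
by have := v0 j (mem_index_enum _); rewrite !mxE -expr2 sqrf_eq0 => /eqP.
Qed.

Lemma sym_idem_mxtrace (R : realDomainType) (d : nat) (P : 'M[R]_d) :
  P^T = P -> P *m P = P -> \tr P = \sum_i \sum_j P i j ^+ 2.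
Proof.
move=> Ps Pi; rewrite -{1}Pi /mxtrace; apply: eq_bigr => i _; rewrite mxE.
by apply: eq_bigr => j _; rewrite -{2}Ps mxE expr2.
Qed.

(** The rows of [A] are an orthonormal basis of the range of [P]. Induction on [k]: a nonzero row of
    [P] is fixed by [P], and with [u] its normalisation, [P - u^T *m u] is a projection of trace one
    less. *)
Lemma sym_idem_factor (R : rcfType) (k d : nat) (P : 'M[R]_d) :
  P^T = P -> P *m P = P -> \tr P = k%:R ->
  exists A : 'M[R]_(k, d), A *m A^T = 1%:M /\ A^T *m A = P.
Proof.
elim: k P => [|k IH] P Ps Pi Pt.
  exists 0; split; first by apply/matrixP => -[].
  rewrite mulmx0; apply/esym/matrixP => i j; rewrite mxE.
  (* The trace is the sum of the squared entries, so trace zero forces [P = 0]. *)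
  have /eqP := Pt; rewrite (sym_idem_mxtrace Ps Pi) psumr_eq0; last first.
    by move=> ? _; apply: sumr_ge0 => ? _; exact: sqr_ge0.
  move=> /allP/(_ i (mem_index_enum _)); rewrite psumr_eq0 => [|? _]; last exact: sqr_ge0.
  by move=> /allP/(_ j (mem_index_enum _)); rewrite sqrf_eq0 => /eqP.
have [i Pi0] : exists i, row i P != 0.
  apply/existsP; rewrite -negb_forall; apply/negP => /forallP P0.
  have P00 : P = 0 by apply/row_matrixP => i; rewrite row0; apply/eqP.
  by move/eqP: Pt; rewrite P00 mxtrace0 eq_sym pnatr_eq0.
have [v [v0 vP]] : exists v : 'rV_d, v != 0 /\ v *m P = v.
  by exists (row i P); rewrite Pi0 -row_mul Pi.
pose q := (v *m v^T) 0 0.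
have q0 : 0 < q.
  rewrite lt_neqAle eq_sym gram_row_eq0 v0 /q mxE sumr_ge0// => j _.
  by rewrite mxE -expr2 sqr_ge0.
pose u := (Num.sqrt q)^-1 *: v.
have uu : u *m u^T = 1%:M.
  rewrite /u linearZ /= -scalemxAl -scalemxAr scalerA -invfM -expr2 sqr_sqrtr ?ltW//.
  by rewrite [v *m _]mx11_scalar scale_scalar_mx mulVf// gt_eqF.
have uP : u *m P = u by rewrite -scalemxAl vP.
have Pu : P *m u^T = u^T by rewrite -{1}Ps -trmx_mul uP.
have [|||A [AA AP]] := IH (P - u^T *m u).
- by rewrite linearB /= trmx_mul trmxK Ps.
- rewrite mulmxBl !mulmxBr Pi mulmxA Pu -!mulmxA uP [u *m (_ *m _)]mulmxA uu mul1mx.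
  by rewrite subrr subr0.
- by rewrite linearB /= mxtrace_mulC uu mxtrace1 Pt mulrSr addrK.
have uA : u *m A^T = 0.
  have : u *m (A^T *m A) *m A^T = 0.
    by rewrite AP mulmxBr uP mulmxA uu mul1mx subrr mul0mx.
  by rewrite -!mulmxA AA mulmx1.
suff : col_mx u A *m (col_mx u A)^T = 1%:M /\ (col_mx u A)^T *m col_mx u A = P.
  by exists (col_mx u A).
rewrite tr_col_mx mul_col_row mul_row_col uu AA AP uA -[A *m u^T]trmxK trmx_mul trmxK uA.
by rewrite trmx0 -scalar_mx_block addrC subrK.
Qed.

(** Each projection has orthonormal bases of its range and of its kernel; [V] carries those of [P]
    to those of [Q]. *)
Lemma sym_idem_conjugate (R : rcfType) (k d : nat) (P Q : 'M[R]_d) : (k <= d)%N ->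
  P^T = P -> P *m P = P -> \tr P = k%:R ->
  Q^T = Q -> Q *m Q = Q -> \tr Q = k%:R ->
  exists V : 'M[R]_d, V *m V^T = 1%:M /\ V *m P *m V^T = Q.
Proof.
move=> kd Ps Pi Pt Qs Qi Qt.
have compl (S : 'M[R]_d) : S^T = S -> S *m S = S -> \tr S = k%:R ->
    exists B : 'M[R]_(d - k, d), B *m B^T = 1%:M /\ B^T *m B = 1%:M - S.
  move=> Ss Si St; apply: sym_idem_factor.
  - by rewrite linearB /= trmx1 Ss.
  - by rewrite mulmxBl !mulmxBr !mul1mx mulmx1 Si subrr subr0.
  - by rewrite linearB /= mxtrace1 St natrB.
have [A [AA AP]] := sym_idem_factor Ps Pi Pt.
have [A' [AA' AQ]] := sym_idem_factor Qs Qi Qt.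
have [B [BB BP]] := compl _ Ps Pi Pt.
have [B' [BB' BQ]] := compl _ Qs Qi Qt.
have BP0 : B *m P = 0.
  by rewrite -[B]mul1mx -BB -!mulmxA (mulmxA _ B) BP mulmxBl mul1mx Pi subrr !mulmx0.
have APA : A *m P = A by rewrite -AP mulmxA AA mul1mx.
have AB0 : A *m B^T = 0.
  by rewrite -APA -mulmxA -{1}Ps -trmx_mul BP0 trmx0 mulmx0.
have BA0 : B *m A^T = 0 by rewrite -[_ *m _]trmxK trmx_mul trmxK AB0 trmx0.
exists (A'^T *m A + B'^T *m B); rewrite linearD /= !trmx_mul !trmxK.
split.
  rewrite mulmxDl !mulmxDr -!mulmxA [A *m (_ *m _)]mulmxA AA mul1mx.
  rewrite [A *m (_ *m _)]mulmxA AB0 mul0mx mulmx0 addr0.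
  rewrite [B *m (_ *m _)]mulmxA BA0 mul0mx mulmx0 add0r.
  by rewrite [B *m (_ *m _)]mulmxA BB mul1mx AQ BQ addrC subrK.
rewrite mulmxDl -!mulmxA APA BP0 mulmx0 addr0 mulmxDr -!mulmxA [A *m (_ *m _)]mulmxA AA.
by rewrite mul1mx AQ [A *m (_ *m _)]mulmxA AB0 mul0mx mulmx0 addr0.
Qed.

(** * Measurability on matrices and of the Grassmannian *)

Lemma continuous_mxP (T : topologicalType) (U : topologicalType) (m n : nat)
    (f : T -> 'M[U]_(m, n)) :
  (forall i j, continuous (fun x => f x i j)) -> continuous f.
Proof.
move=> cf x A [B fB BA]; apply: (@filterS _ (nbhs x) _ [set y | forall i j, B i j (f y i j)]).
  by move=> y By; exact: BA.
by apply: filter_forall => i; apply: filter_forall => j; exact: (cf i j x _ (fB i j)).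
Qed.

Section grassmannian.
Context {R : realType} {d : nat}.
Implicit Types (P Q : 'M[R]_d) (k : nat).

Lemma open_measurable_mxB (A : set 'M[R]_d) : open A -> measurable (A : set (mxB R d)).
Proof. exact: sub_sigma_algebra. Qed.

Lemma measurable_entry i j :
  measurable_fun [set: mxB R d] (fun P : mxB R d => (P : 'M[R]_d) i j).
Proof.
apply: (measurability _ (RGenOpens.measurableE R)).
move=> _ [_ [a [b ->] <-]]; rewrite setTI; apply: open_measurable_mxB.
have /continuousP := @coord_continuous R d d i j.
by apply; exact: interval_open.
Qed.

Lemma measurable_mulmx2 (U V : 'M[R]_d) :
  measurable_fun [set: mxB R d] (fun P : mxB R d => (U *m P *m V : mxB R d)).
Proof.
apply: (@measurability _ _ _ (mxB R d) _ _ (open : set (set 'M[R]_d))) => // _ [A oA <-].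
rewrite setTI; apply: open_measurable_mxB; move: A oA; apply/continuousP.
apply: continuous_mxP => i j.
rewrite (_ : (fun _ => _) = fun P : 'M[R]_d => \sum_l \sum_m U i m * P m l * V l j).
  apply: continuous_big => [|l _]; first exact: add_continuous.
  apply: continuous_big => [|m _]; first exact: add_continuous.
  move=> x; apply: (@continuousM R _ (fun P : 'M[R]_d => U i m * P m l) (cst (V l j))).
    apply: (@continuousM R _ (cst (U i m)) (fun P : 'M[R]_d => P m l)).
      exact: cst_continuous.
    exact: coord_continuous.
  exact: cst_continuous.
by apply/funext => P; rewrite mxE; apply: eq_bigr => l _; rewrite mxE mulr_suml.
Qed.

Lemma measurable_grass k : measurable (@grass R k d).
Proof.
(* The defining equations enter as one sum of squares, whose zero set is the Grassmannian. *)
pose g P : R := \sum_i \sum_j (P j i - P i j) ^+ 2 +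
  \sum_i \sum_j (\sum_l P i l * P l j - P i j) ^+ 2 + (\sum_i P i i - k%:R) ^+ 2.
have mg : measurable_fun [set: mxB R d] g.
  have me := measurable_entry.
  apply: measurable_funD; first apply: measurable_funD.
  - do 2!(apply: measurable_sum => ?).
    by apply: measurable_funX; apply: measurable_funB; exact: me.
  - do 2!(apply: measurable_sum => ?).
    apply: measurable_funX; apply: measurable_funB; last exact: me.
    by apply: measurable_sum => ?; apply: measurable_funM; exact: me.
  - apply: measurable_funX; apply: measurable_funB; last exact: measurable_cst.
    by apply: measurable_sum => ?; exact: me.
have ss0 (F : 'I_d -> 'I_d -> R) : 0 <= \sum_i \sum_j F i j ^+ 2.
  by do 2!(apply: sumr_ge0 => ? _); exact: sqr_ge0.
have ss0P (F : 'I_d -> 'I_d -> R) : \sum_i \sum_j F i j ^+ 2 = 0 -> forall i j, F i j = 0.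
  move=> /eqP; rewrite psumr_eq0 => [/allP F0 i j|? _]; last first.
    by apply: sumr_ge0 => ? _; exact: sqr_ge0.
  have := F0 i (mem_index_enum _); rewrite psumr_eq0 => [/allP|? _]; last exact: sqr_ge0.
  by move=> /(_ j (mem_index_enum _)); rewrite sqrf_eq0 => /eqP.
rewrite (_ : @grass R k d = [set: mxB R d] `&` g @^-1` [set 0]); first exact: mg.
rewrite setTI; apply/seteqP; split => P /=.
  move=> [Ps [Pi Pt]]; rewrite /g -[X in (X - k%:R) ^+ 2]/(\tr P) Pt subrr expr0n addr0.
  rewrite big1 ?add0r => [|i _]; last first.
    by rewrite big1// => j _; have /matrixP/(_ i j) := Ps; rewrite mxE => ->; rewrite subrr expr0n.
  rewrite big1// => i _; rewrite big1// => j _.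
  by have /matrixP/(_ i j) := Pi; rewrite mxE => ->; rewrite subrr expr0n.
move=> /eqP; rewrite /g paddr_eq0 ?addr_ge0 ?sqr_ge0// paddr_eq0//.
move=> /andP[/andP[/eqP/ss0P h1 /eqP/ss0P h2]]; rewrite sqrf_eq0 => /eqP h3.
split; last split; last by apply/eqP; rewrite -subr_eq0; apply/eqP.
  by apply/matrixP => i j; rewrite mxE; apply/eqP; rewrite -subr_eq0 h1.
by apply/matrixP => i j; rewrite mxE; apply/eqP; rewrite -subr_eq0 h2.
Qed.

End grassmannian.

(* [G] generates the sub-sigma-algebra of the past; independence of [Y] from the
   past makes the law of [w |-> (w, Y w)], with the first coordinate observed
   through [<<s G >>] only, a product measure. *)
Lemma integral_indep_pair (R : realType) (dO dT : measure_display)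
    (O : measurableType dO) (T : measurableType dT) (PP : probability O R)
    (nu : probability T R) (G : set (set O)) (Y : O -> T)
    (h : g_sigma_algebraType G * T -> \bar R) :
  G `<=` measurable -> setI_closed G -> G setT -> measurable_fun setT Y ->
  (forall A B, G A -> measurable B -> PP (A `&` Y @^-1` B) = (PP A * nu B)%E) ->
  measurable_fun setT h -> (forall z, (0 <= h z)%E) ->
  (\int[PP]_w h (w, Y w) = \int[PP]_w \int[nu]_y h (w, y))%E.
Proof.
move=> Gm GI GT mY indep mh h0.
pose i0 : O -> g_sigma_algebraType G := fun w => w.
have sGm : <<s G >> `<=` (measurable : set (set O)).
  by apply: smallest_sub => //; exact: sigma_algebra_measurable.
have mi : measurable_fun setT i0 by move=> _ A mA; rewrite setTI; exact: sGm.
pose ji : {mfun O >-> g_sigma_algebraType G} :=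
  HB.pack i0 (isMeasurableFun.Build _ _ _ _ _ mi).
pose p0 w := (i0 w, Y w).
have mp : measurable_fun setT p0 by exact: measurable_fun_pair.
pose jp : {mfun O >-> (g_sigma_algebraType G * T)%type} :=
  HB.pack p0 (isMeasurableFun.Build _ _ _ _ _ mp).
(* Both sides are finite measures in [A] that agree on the pi-system [G], hence on [<<s G >>]. *)
have rect A B : <<s G >> A -> measurable B -> PP (A `&` Y @^-1` B) = (PP A * nu B)%E.
  move=> GA mB; have mYB : measurable (Y @^-1` B) by rewrite -[_ @^-1` _]setTI; exact: mY.
  have nuB : (0 <= fine (nu B))%R by rewrite fine_ge0.
  have scaleE A1 : mscale (NngNum nuB) PP A1 = (PP A1 * nu B)%E.
    by rewrite /mscale /= fineK ?fin_num_measure// muleC.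
  rewrite -scaleE -[LHS]/(mrestr PP mYB A).
  apply: (@g_sigma_algebra_measure_unique _ R O G Gm (fun=> setT) (fun=> GT) _ _ _ GI _ _ A GA).
  - by rewrite bigcup_const.
  - by move=> A1 GA1; rewrite -[RHS]/(mscale (NngNum nuB) PP A1) scaleE; exact: indep.
  - by move=> _; rewrite /= /mrestr setTI (le_lt_trans (probability_le1 _ _))// ltry.
pose m1 : probability _ R := distribution PP ji.
pose m2 : measure _ R := distribution PP jp.
have prodE X : measurable X -> (m1 \x nu)%E X = m2 X.
  apply: product_measure_unique => A B mA mB.
  exact: (rect A B mA mB).
transitivity (\int[m2]_z h z)%E.
  by rewrite /m2 /distribution ge0_integral_pushforward.
transitivity (\int[(m1 \x nu)%E]_z h z)%E.
  by apply/esym/eq_measure_integral => A mA _; exact: prodE.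
rewrite fubini_tonelli1//.
rewrite /m1 /distribution ge0_integral_pushforward//.
- exact: measurable_fun_fubini_tonelli_F.
- by move=> w _; exact: integral_ge0.
Qed.

(** * Exponential moments of sums of independent vectors *)

(** Lagrange's identity: the double sum of squared minors is twice the difference of the two
    sides. *)
Lemma cauchy_schwarz_sum (R : realDomainType) (F : finType) (u v : F -> R) :
  (\sum_f u f * v f) ^+ 2 <= (\sum_f u f ^+ 2) * (\sum_f v f ^+ 2).
Proof.
have lagrange : 0 <= \sum_f \sum_g (u f * v g - u g * v f) ^+ 2.
  by do 2!(apply: sumr_ge0 => ? _); exact: sqr_ge0.
have E : \sum_f \sum_g (u f * v g - u g * v f) ^+ 2 =
    (\sum_f u f ^+ 2) * (\sum_g v g ^+ 2) + (\sum_f v f ^+ 2) * (\sum_g u g ^+ 2)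
    - 2 * ((\sum_f u f * v f) * (\sum_g u g * v g)).
  rewrite !big_distrlr /= mulr_sumr -big_split /= -sumrB; apply: eq_bigr => f _.
  rewrite mulr_sumr -big_split /= -sumrB; apply: eq_bigr => g _; ring.
move: lagrange; rewrite E; lra.
Qed.

Section pinelis.
Context {R : realType} {F : finType}.
Implicit Types u v : F -> R.

Definition enorm v : R := Num.sqrt (\sum_f v f ^+ 2).

Lemma sumsq_ge0 v : 0 <= \sum_f v f ^+ 2.
Proof. by apply: sumr_ge0 => f _; exact: sqr_ge0. Qed.

Lemma enorm_ge0 v : 0 <= enorm v. Proof. exact: sqrtr_ge0. Qed.

Lemma sqr_enorm v : enorm v ^+ 2 = \sum_f v f ^+ 2.
Proof. by rewrite sqr_sqrtr// sumsq_ge0. Qed.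

(** Cauchy-Schwarz supplies the hypothesis of [cosh_add_le] on the inner product; [b] stands for a
    bound on the norm of [v]. *)
Lemma cosh_enorm_add_le u v b : 0 <= b -> \sum_f v f ^+ 2 <= b ^+ 2 ->
  cosh (enorm (fun f => u f + v f)) <=
  cosh (enorm u) * (expR b - b) + sinh (enorm u) / enorm u * \sum_f u f * v f.
Proof.
move=> b0 vb; apply: cosh_add_le => //; first exact: enorm_ge0.
  rewrite -(@ler_pXn2r _ 2)// ?nnegrE ?mulr_ge0 ?enorm_ge0//.
  rewrite exprMn sqr_enorm real_normK ?num_real//.
  by rewrite (le_trans (cauchy_schwarz_sum _ _))// ler_wpM2l// sumsq_ge0.
rewrite !sqr_enorm (le_trans _ (lerD (lerD (lexx _) vb) (lexx _)))//.
rewrite mulr_sumr -!big_split /= le_eqVlt; apply/orP; left; apply/eqP.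
apply: eq_bigr => f _; ring.
Qed.

Lemma measurable_continuous_comp (d : measure_display) (T : measurableType d)
    (g : R -> R) (f : T -> R) : continuous g -> measurable_fun setT f ->
  measurable_fun setT (fun y => g (f y)).
Proof.
move=> cg mf; apply: (@measurableT_comp _ _ _ _ _ _ g) => //.
exact: continuous_measurable_fun.
Qed.

Lemma measurable_cosh_enorm (d : measure_display) (T : measurableType d)
    (v : T -> F -> R) : (forall f, measurable_fun setT (fun y => v y f)) ->
  measurable_fun setT (fun y => cosh (enorm (v y))).
Proof.
move=> mv.
have mn : measurable_fun setT (fun y => enorm (v y)).
  apply: (measurable_continuous_comp (@sqrt_continuous R)).
  by apply: measurable_sum => f; apply: measurable_funX; exact: mv.
apply: measurable_funM; last exact: measurable_cst.
apply: measurable_funD; apply: (measurable_continuous_comp (@continuous_expR R)) => //.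
exact: measurable_funN.
Qed.

Section one_step.
Context (d : measure_display) (T : measurableType d) (nu : probability T R).
Context (xi : T -> F -> R) (b : R).
Hypotheses (b0 : 0 <= b) (mxi : forall f, measurable_fun setT (fun y => xi y f)).
Hypothesis xib : forall y, \sum_f xi y f ^+ 2 <= b ^+ 2.
Hypothesis xi0 : forall f, (\int[nu]_y (xi y f)%:E = 0)%E.

Lemma centred_integrable f : nu.-integrable setT (EFin \o (fun y => xi y f)).
Proof.
apply: measurable_bounded_integrable => //.
  by rewrite (le_lt_trans (probability_le1 _ _))// ltry.
exists b; split; first exact: num_real.
move=> x bx y _ /=; rewrite (le_trans _ (ltW bx))//.
rewrite -(@ler_pXn2r _ 2)// ?nnegrE// real_normK ?num_real//.
rewrite (le_trans _ (xib y))// (bigD1 f)//= lerDl.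
by apply: sumr_ge0 => ? _; exact: sqr_ge0.
Qed.

(** In the integrated pointwise bound, the term linear in [xi y] vanishes: its coefficients do not
    depend on [y] and [xi] has mean zero. *)
Lemma integral_cosh_enorm_add_le u :
  (\int[nu]_y (cosh (enorm (fun f => u f + xi y f)))%:E <=
   (cosh (enorm u) * (expR b - b))%:E)%E.
Proof.
set c := sinh (enorm u) / enorm u.
pose g y := c * \sum_f u f * xi y f.
have ig f : nu.-integrable setT (fun y => (c * u f)%:E * (xi y f)%:E)%E.
  exact: (integrableZl _ _ (centred_integrable f)).
have gE : (fun y => (g y)%:E) = (fun y => \sum_f (c * u f)%:E * (xi y f)%:E)%E.
  apply/funext => y; rewrite /g mulr_sumr -sumEFin; apply: eq_bigr => f _.
  by rewrite mulrA EFinM.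
have g0 : (\int[nu]_y (g y)%:E = 0)%E.
  rewrite gE integral_sum//; apply: big1 => f _.
  by rewrite integralZl ?xi0 ?mule0//; exact: centred_integrable.
have igg : nu.-integrable setT (fun y => (g y)%:E) by rewrite gE; exact: integrable_sum.
have icst : nu.-integrable setT (fun=> (cosh (enorm u) * (expR b - b))%:E).
  exact: finite_measure_integrable_cst.
rewrite (@le_trans _ _ (\int[nu]_y ((cosh (enorm u) * (expR b - b))%:E + (g y)%:E)))%E//.
  apply: ge0_le_integral => //.
  - by move=> y _; rewrite lee_fin cosh_ge0.
  - apply/measurable_EFinP; apply: measurable_cosh_enorm => f.
    by apply: measurable_funD => //; exact: mxi.
  - by apply: (measurable_int nu); exact: integrableD.
  - by move=> y _; rewrite -EFinD lee_fin; exact: cosh_enorm_add_le.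
rewrite integralD// g0 adde0 integral_cst//.
rewrite -[leRHS]mule1; apply: lee_wpmul2l; last exact: probability_le1.
rewrite lee_fin mulr_ge0 ?cosh_ge0//; have := expR_ge1Dx b; lra.
Qed.

End one_step.

Section independent_sum.
Context (dO d : measure_display) (O : measurableType dO) (T : measurableType d).
Context (PP : probability O R) (nu : probability T R) (xi : T -> F -> R) (b : R).
Hypotheses (b0 : 0 <= b) (mxi : forall f, measurable_fun setT (fun y => xi y f)).
Hypothesis xib : forall y, \sum_f xi y f ^+ 2 <= b ^+ 2.
Hypothesis xi0 : forall f, (\int[nu]_y (xi y f)%:E = 0)%E.
Context (n : nat) (X : 'I_n -> O -> T).
Hypothesis mX : forall i, measurable_fun setT (X i).
Hypothesis lawX : forall i A, measurable A -> PP (X i @^-1` A) = nu A.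
Hypothesis indX : forall A : 'I_n -> set T, (forall i, measurable (A i)) ->
  PP (\bigcap_i (X i @^-1` A i)) = (\prod_(i < n) PP (X i @^-1` A i))%E.

(** Cylinders over the first [j] variables: a pi-system that generates their sigma-algebra and on
    which independence is a product formula. *)
Let past (j : nat) : set (set O) := [set E | exists A : 'I_n -> set T,
  (forall i, measurable (A i)) /\ E = \bigcap_(i in [set i : 'I_n | (i < j)%N]) (X i @^-1` A i)].

Let pastI j : setI_closed (past j).
Proof.
move=> _ _ [A [mA ->]] [B [mB ->]]; exists (fun i => A i `&` B i); split.
  by move=> i; exact: measurableI.
by rewrite -bigcapI.
Qed.

Let past_setT j : past j setT.
Proof. by exists (fun=> setT); split => //; apply/seteqP; split => w. Qed.

Let past_measurable j : past j `<=` measurable.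
Proof.
move=> _ [A [mA ->]]; apply: fin_bigcap_measurable => // i _.
by rewrite -[_ @^-1` _]setTI; exact: mX.
Qed.

Let past_indep (j : 'I_n) A B : past j A -> measurable B ->
  PP (A `&` X j @^-1` B) = (PP A * nu B)%E.
Proof.
move=> [C [mC ->]] mB.
(* Padding with [setT] makes both events intersections over all indices, to which [indX] applies. *)
pose D1 (i : 'I_n) := if (i < j)%N then C i else setT.
pose D2 i := if i == j then B else D1 i.
have mD1 i : measurable (D1 i) by rewrite /D1; case: ifP.
have mD2 i : measurable (D2 i) by rewrite /D2; case: ifP.
have E1 : \bigcap_(i in [set i : 'I_n | (i < j)%N]) (X i @^-1` C i) =
    \bigcap_i (X i @^-1` D1 i).
  apply/seteqP; split => w Hw i /=.
    by move=> _; rewrite /D1; case: ifPn => // ij; exact: Hw.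
  by move=> ij; have := Hw i I; rewrite /D1 /= ij.
have E2 : \bigcap_(i in [set i : 'I_n | (i < j)%N]) (X i @^-1` C i) `&` X j @^-1` B =
    \bigcap_i (X i @^-1` D2 i).
  rewrite E1; apply/seteqP; split => w.
    by move=> [Hw wB] i _; rewrite /D2 /=; case: eqP => [->//|_]; exact: Hw.
  move=> Hw; split.
    move=> i _ /=; have := Hw i I; rewrite /D2 /=; case: eqP => [-> _|//].
    by rewrite /D1 ltnn.
  by have := Hw j I; rewrite /D2 /= eqxx.
rewrite E2 E1 !indX// (bigD1 j)//= [in RHS](bigD1 j)//= {1}/D2 eqxx lawX//.
rewrite {1}/D1 ltnn preimage_setT probability_setT mul1e muleC; congr (_ * _)%E.
by apply: eq_bigr => i /negbTE ij; rewrite /D2 ij.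
Qed.

(** Induction over partial sums: with the past fixed, each new summand costs a factor
    [expR b - b]. *)
Lemma expectation_cosh_enorm_sum_le :
  (\int[PP]_w (cosh (enorm (fun f => \sum_(i < n) xi (X i w) f)))%:E <=
   ((expR b - b) ^+ n)%:E)%E.
Proof.
pose S j w f := \sum_(i < n | (i < j)%N) xi (X i w) f.
have mS j f : measurable_fun [set: g_sigma_algebraType (past j)] (fun w => S j w f).
  rewrite /S; under eq_fun do rewrite big_mkcond /=.
  apply: measurable_sum => i /=; have [ij|_] := boolP (i < j)%N; last exact: measurable_cst.
  apply: (measurableT_comp (mxi f)) => _ A mA; rewrite setTI.
  apply: sub_sigma_algebra; exists (fun k => if k == i then A else setT).
  split; first by move=> k; case: ifP.
  apply/seteqP; split => w /=.
    by move=> wA k _ /=; case: eqP => [->|].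
  by move=> /(_ i ij) /=; rewrite eqxx.
suff main j : (j <= n)%N ->
    (\int[PP]_w (cosh (enorm (S j w)))%:E <= ((expR b - b) ^+ j)%:E)%E.
  apply: le_trans (main n (leqnn n)); rewrite le_eqVlt; apply/orP; left; apply/eqP.
  apply: eq_integral => w _.
  by congr (cosh (enorm _))%:E; apply/funext => f; apply: eq_bigl => i; rewrite ltn_ord.
elim: j => [_|j IH jn].
  rewrite expr0; under eq_integral => w _.
    rewrite (_ : S 0%N w = fun=> 0); last by apply/funext => f; exact: big_pred0.
    rewrite /enorm big1 ?sqrtr0; last by move=> f _; rewrite expr0n.
    rewrite /cosh oppr0 expR0 -mulr2n -mulr_natl mulr1 divff//.
    over.
  by rewrite integral_cst// mul1e; exact: probability_le1.
pose J := Ordinal jn.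
have SE w : S j.+1 w = fun f => S j w f + xi (X J w) f.
  apply/funext => f; rewrite /S (bigD1 J)//= addrC; congr (_ + _).
  apply: eq_bigl => i; rewrite ltnS andbC -(inj_eq val_inj) /= [RHS]ltn_neqAle //.
pose h (z : g_sigma_algebraType (past j) * T) : \bar R :=
  (cosh (enorm (fun f => S j z.1 f + xi z.2 f)))%:E.
have mh : measurable_fun setT h.
  apply/measurable_EFinP; apply: measurable_cosh_enorm => f; apply: measurable_funD.
    exact: (measurableT_comp (mS j f)).
  exact: (measurableT_comp (mxi f)).
have h0 z : (0 <= h z)%E by rewrite lee_fin cosh_ge0.
have -> : (\int[PP]_w (cosh (enorm (S j.+1 w)))%:E = \int[PP]_w h (w, X J w))%E.
  by apply: eq_integral => w _; rewrite SE.
rewrite (integral_indep_pair (@past_measurable j) (@pastI j) (past_setT j) (mX J)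
  (@past_indep J) mh h0).
have sub : <<s past j >> `<=` (measurable : set (set O)).
  by apply: smallest_sub => //; exact: sigma_algebra_measurable.
(* The sigma-algebra of the past is coarser than that of [O]. *)
have lift (g : O -> \bar R) : measurable_fun [set: g_sigma_algebraType (past j)] g ->
    measurable_fun [set: O] g.
  by move=> mg _ A mA; apply: sub; exact: mg.
have mSO f : measurable_fun [set: O] (fun w => S j w f).
  by move=> _ A mA; apply: sub; exact: mS.
have eb : 0 <= expR b - b by have := expR_ge1Dx b; lra.
rewrite (@le_trans _ _ (\int[PP]_w ((expR b - b)%:E * (cosh (enorm (S j w)))%:E)))%E//.
  apply: ge0_le_integral => //.
  - by move=> w _; exact: integral_ge0.
  - apply: lift; exact: (measurable_fun_fubini_tonelli_F (m2 := nu)).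
  - apply: measurable_funeM; apply/measurable_EFinP; exact: measurable_cosh_enorm.
  - move=> w _; rewrite -EFinM mulrC.
    exact: (integral_cosh_enorm_add_le b0 mxi xib xi0 (S j w)).
rewrite ge0_integralZl//.
- by rewrite exprS EFinM; apply: lee_wpmul2l; [rewrite lee_fin|exact: IH (ltnW jn)].
- by apply/measurable_EFinP; exact: measurable_cosh_enorm.
- by move=> w _; rewrite lee_fin cosh_ge0.
Qed.

End independent_sum.
End pinelis.

(** * Tail of the norm of the sum *)

Section tail_bound.
Context {R : realType} {F : finType} (dO d : measure_display) (O : measurableType dO).
Context (T : measurableType d).
Context (PP : probability O R) (nu : probability T R) (xi : T -> F -> R) (b : R).
Hypotheses (b0 : 0 <= b) (mxi : forall f, measurable_fun setT (fun y => xi y f)).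
Hypothesis xib : forall y, \sum_f xi y f ^+ 2 <= b ^+ 2.
Hypothesis xi0 : forall f, (\int[nu]_y (xi y f)%:E = 0)%E.
Context (n : nat) (X : 'I_n -> O -> T).
Hypothesis mX : forall i, measurable_fun setT (X i).
Hypothesis lawX : forall i A, measurable A -> PP (X i @^-1` A) = nu A.
Hypothesis indX : forall A : 'I_n -> set T, (forall i, measurable (A i)) ->
  PP (\bigcap_i (X i @^-1` A i)) = (\prod_(i < n) PP (X i @^-1` A i))%E.

Let S w f : R := \sum_(i < n) xi (X i w) f.

Let mS f : measurable_fun setT (fun w => S w f).
Proof. by apply: measurable_sum => i; exact: (measurableT_comp (mxi f)). Qed.

Lemma measurable_enorm_tail (s : R) : measurable [set w | s <= enorm (S w)].
Proof.
have mn : measurable_fun setT (fun w => enorm (S w)).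
  apply: (measurable_continuous_comp (@sqrt_continuous R)).
  by apply: measurable_sum => f; apply: measurable_funX; exact: mS.
have := mn measurableT _ (measurable_itv `[s, +oo[); rewrite setTI.
by congr (measurable _); apply/seteqP; split => w /=; rewrite in_itv /= andbT.
Qed.

(** Markov's inequality for [cosh] of the norm: on the event it is at least [expR s / 2], whence the
    factor 2. *)
Lemma enorm_sum_tail (s : R) : 0 <= s ->
  (PP [set w | (s <= enorm (S w))%R] <= (2 * expR (- s) * (expR b - b) ^+ n)%:E)%E.
Proof.
move=> s0; set A := [set w | _].
have mA : measurable A by exact: measurable_enorm_tail.
have mc : measurable_fun setT (fun w => (cosh (enorm (S w)))%:E).
  by apply/measurable_EFinP; exact: measurable_cosh_enorm.
have M : ((expR s / 2)%:E * PP A <= ((expR b - b) ^+ n)%:E)%E.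
  apply: le_trans (expectation_cosh_enorm_sum_le b0 mxi xib xi0 mX lawX indX).
  rewrite -integral_cst//.
  rewrite (@le_trans _ _ (\int[PP]_(w in A) (cosh (enorm (S w)))%:E))%E//.
    apply: ge0_le_integral => //.
    - by move=> w _; rewrite lee_fin divr_ge0// expR_ge0.
    - exact: measurable_funTS.
    - move=> w /= sw; rewrite lee_fin (le_trans _ (cosh_le s0 sw))//.
      by rewrite /cosh; have := expR_ge0 (- s); lra.
  by apply: ge0_subset_integral => // w _; rewrite lee_fin cosh_ge0.
have -> : PP A = ((2 * expR (- s))%:E * ((expR s / 2)%:E * PP A))%E.
  rewrite muleA -EFinM (_ : 2 * _ * _ = expR (- s) * expR s); last by field.
  by rewrite -expRD addNr expR0 mul1e.
by rewrite [leRHS]EFinM; apply: lee_wpmul2l => //; rewrite lee_fin mulr_ge0// expR_ge0.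
Qed.

End tail_bound.

(** * The tensor-power embedding *)

Section tensor_feature.
Context {R : realType} {d t : nat}.
Implicit Types (P Q : 'M[R]_d).
Let F := {ffun 'I_t -> 'I_d * 'I_d}.

(* The entries of the [t]-fold tensor power of [P], so that [K_t(P, Q)] is a
   Euclidean inner product. *)
Definition feature P (f : F) : R := \prod_s P (f s).1 (f s).2.

(** The [t]-th power of a sum over index pairs expands into a sum over [t]-tuples of pairs. *)
Lemma feature_dot P Q :
  \sum_f feature P f * feature Q f = (\sum_i \sum_j P i j * Q i j) ^+ t.
Proof.
rewrite pair_bigA /= -[in RHS](card_ord t) -prodr_const bigA_distr_bigA /=.
by apply: eq_bigr => f _; rewrite -big_split.
Qed.

Lemma feature_dot_sym P Q : Q^T = Q -> \sum_f feature P f * feature Q f = Kt t P Q.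
Proof.
move=> Qs; rewrite feature_dot /Kt /mxtrace; congr (_ ^+ _).
apply: eq_bigr => i _; rewrite mxE; apply: eq_bigr => j _.
by rewrite -{1}Qs mxE.
Qed.

(** Each feature is a monomial of degree [t] in the entries, so a cubature reproduces its mean. *)
Lemma polyfun_feature f : polyfun_le t (feature^~ f).
Proof.
exists (\prod_s mpoly.mpolyX R (mpoly.mnm1 (mxvec_index (f s).1 (f s).2))); split.
  rewrite mpoly.mprodXE mpoly.msuppX /= andbT mpoly.mdeg_sum.
  rewrite (eq_bigr (fun=> 1%N)) => [|s _]; last exact: mpoly.mdeg1.
  by rewrite sum1_card card_ord.
move=> P; rewrite rmorph_prod /=; apply: eq_bigr => s _.
by rewrite mpoly.mevalXU mxvecE.
Qed.

Lemma measurable_feature f :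
  measurable_fun [set: mxB R d] (fun P : mxB R d => feature P f).
Proof. by apply: measurable_prod => s _; exact: measurable_entry. Qed.

End tensor_feature.

(** * Features averaged over the Grassmannian *)

Section grassmannian_feature.
Context {R : realType} {k d t : nat}.
Implicit Types (P Q : 'M[R]_d) (m : probability (mxB R d) R).
Let F := {ffun 'I_t -> 'I_d * 'I_d}.
Local Notation G := (@grass R k d).

Lemma feature_sqnorm P : G P -> \sum_(f : F) feature P f ^+ 2 = (k%:R : R) ^+ t.
Proof.
move=> [Ps [Pi Pt]]; rewrite -Pt -[X in \tr X]Pi -[RHS]/(Kt t P P) -feature_dot_sym//.
Qed.

(** A squared coordinate is at most the squared norm [k%:R ^+ t], hence at most
    [(1 + k%:R ^+ t) ^+ 2]; this form avoids a square root. *)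
Lemma feature_bounded P (f : F) : G P -> `|feature P f| <= 1 + (k%:R : R) ^+ t.
Proof.
move=> GP; have k0 : 0 <= (k%:R : R) ^+ t by exact: exprn_ge0.
rewrite -(@ler_pXn2r _ 2)// ?nnegrE ?addr_ge0// real_normK ?num_real//.
rewrite (@le_trans _ _ ((k%:R : R) ^+ t))//; last by nra.
rewrite -(feature_sqnorm GP) (bigD1 f)//= lerDl.
by apply: sumr_ge0 => ? _; exact: sqr_ge0.
Qed.

Lemma feature_integrable m (f : F) : m.-integrable G (fun P => (feature P f)%:E).
Proof.
apply: (@measurable_bounded_integrable _ _ _ m (feature^~ f)).
- exact: measurable_grass.
- by rewrite (le_lt_trans (probability_le1 _ _)) ?ltry//; exact: measurable_grass.
- exact: measurable_funTS (measurable_feature f).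
- exists (1 + (k%:R : R) ^+ t); split; first exact: num_real.
  by move=> x xk P GP /=; rewrite (le_trans (feature_bounded f GP))// ltW.
Qed.

Definition feature_mean m (f : F) : R := fine (\int[m]_(P in G) (feature P f)%:E)%E.

Lemma feature_meanE m f :
  (\int[m]_(P in G) (feature P f)%:E)%E = (feature_mean m f)%:E.
Proof.
rewrite /feature_mean fineK//; apply: integrable_fin_num.
  exact: measurable_grass.
exact: feature_integrable.
Qed.

Lemma integral_feature_comb m (a : F -> R) :
  (\int[m]_(P in G) (\sum_f a f * feature P f)%:E = (\sum_f a f * feature_mean m f)%:E)%E.
Proof.
have mG := @measurable_grass R d k.
under eq_integral do rewrite -sumEFin.
rewrite integral_sum => [||f]; [|exact: mG|]; last first.
  under eq_fun do rewrite EFinM.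
  by apply: integrableZl => //; exact: feature_integrable.
rewrite -sumEFin; apply: eq_bigr => f _; under eq_integral do rewrite EFinM.
by rewrite integralZl// ?feature_meanE//; exact: feature_integrable.
Qed.

Lemma integral_Kt m P :
  (\int[m]_(Q in G) (Kt t P Q)%:E = (\sum_f feature P f * feature_mean m f)%:E)%E.
Proof.
rewrite -integral_feature_comb; apply: eq_integral => Q /set_mem [Qs _].
by rewrite feature_dot_sym.
Qed.

(** Both integrals act linearly on the features, so the double integral of the inner product is the
    inner product of the means. *)
Lemma lambda_tE m : lambda_t k t m = \sum_f feature_mean m f ^+ 2.
Proof.
rewrite /lambda_t; under eq_integral => P _.
  rewrite integral_Kt (eq_bigr (fun f => feature_mean m f * feature P f)) => [|f _].
    over.
  by rewrite mulrC.
by rewrite integral_feature_comb.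
Qed.

(* Orthogonal invariance makes the average constant on orbits, and the
   Grassmannian is a single orbit. *)
Lemma feature_dot_mean sigma P : (k <= d)%N -> orth_invariant_grass_measure k sigma ->
  G P -> \sum_f feature P f * feature_mean sigma f = lambda_t k t sigma.
Proof.
move=> kd [sG sinv] GP; have mG := @measurable_grass R d k.
have orbit Q : G Q ->
    \sum_f feature Q f * feature_mean sigma f = \sum_f feature P f * feature_mean sigma f.
  move=> [Qs [Qi Qt]]; have [Ps [Pi Pt]] := GP.
  have [V [VV VP]] := sym_idem_conjugate kd Ps Pi Pt Qs Qi Qt.
  have VV' := mulmx1C VV.
  (* Conjugation by the transpose of [V] moves [V] from one argument of [Kt] to the other, and
     preserves [sigma] and the Grassmannian. *)
  pose c (S : mxB R d) : mxB R d := V^T *m S *m V^T^T.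
  have mc : measurable_fun setT c by exact: measurable_mulmx2.
  pose jc : {mfun mxB R d >-> mxB R d} :=
    HB.pack c (isMeasurableFun.Build _ _ _ _ _ mc).
  have cG S : G (c S) <-> G S.
    have trc (W S' : 'M[R]_d) : W *m W^T = 1%:M -> G S' -> G (W^T *m S' *m W^T^T).
      move=> WW [S's [S'i S't]]; rewrite trmxK; split; last split.
      - by rewrite !trmx_mul trmxK S's mulmxA.
      - rewrite !mulmxA -[_ *m W *m W^T]mulmxA WW mulmx1.
        by rewrite -[_ *m S' *m S']mulmxA S'i.
      - by rewrite mxtrace_mulC mulmxA WW mul1mx.
    split; last exact: trc.
    have := trc V^T (c S); rewrite !trmxK => /(_ VV') H /H; rewrite /c !trmxK.
    by rewrite !mulmxA VV mul1mx -mulmxA VV mulmx1.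
  apply: EFin_inj; rewrite -!integral_Kt -{1}VP.
  transitivity (\int[sigma]_(S in G) (Kt t P (c S))%:E)%E.
    apply: eq_integral => S _; rewrite /Kt /c trmxK -!mulmxA mxtrace_mulC.
    by rewrite !mulmxA.
  have mK : measurable_fun [set: mxB R d] (fun S : mxB R d => (Kt t P S)%:E).
    apply/measurable_EFinP; rewrite /Kt; apply: measurable_funX.
    apply: measurable_sum => i; under eq_fun do rewrite mxE.
    apply: measurable_sum => j; apply: measurable_funM => //; exact: measurable_entry.
  have E : c @^-1` G = G by apply/seteqP; split => S /cG.
  have iK : sigma.-integrable G (fun S : mxB R d => (Kt t P (c S))%:E).
    apply: (eq_integrable _ (fun S => \sum_f (feature P f)%:E * (feature (c S) f)%:E)%E) => //.
      move=> S /set_mem/cG [cs _]; rewrite -feature_dot_sym// -sumEFin.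
      by apply: eq_bigr => f _; rewrite EFinM.
    apply: integrable_sum => // f _; apply: integrableZl => //.
    apply: (@measurable_bounded_integrable _ _ _ sigma (fun S => feature (c S) f)) => //.
    - by rewrite (le_lt_trans (probability_le1 _ _)) ?ltry.
    - apply: measurable_funTS; exact: (measurableT_comp (measurable_feature f)).
    - exists (1 + (k%:R : R) ^+ t); split; first exact: num_real.
      by move=> x xk S /cG GS /=; rewrite (le_trans (feature_bounded f GS))// ltW.
  (* Change of variables: [c] pushes [sigma] forward to itself. *)
  rewrite -{1}E -(integral_pushforward mc (f := fun S => (Kt t P S)%:E)) ?E//.
  apply: (@eq_measure_integral _ _ _ _ sigma (pushforward sigma jc)) => A mA _.
  have VVT : V^T *m V^T^T = 1%:M by rewrite trmxK.
  exact: (sinv _ VVT A mA).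
(* The constant is identified by averaging it over the Grassmannian, which has mass 1. *)
apply: EFin_inj; rewrite lambda_tE.
transitivity (\int[sigma]_(Q in G) (\sum_f feature_mean sigma f * feature Q f)%:E)%E.
  rewrite (eq_integral (cst (\sum_f feature P f * feature_mean sigma f)%:E)).
    rewrite integral_cst//.
    apply/esym; apply: etrans (mule1 _); congr (_ * _)%E; exact: sG.
  move=> Q /set_mem GQ /=; rewrite -(orbit Q GQ); congr EFin.
  by apply: eq_bigr => f _; rewrite mulrC.
by rewrite integral_feature_comb.
Qed.

End grassmannian_feature.

(** * Centred features *)

Section centred_feature.
Context {R : realType} {k d t : nat} (sigma : probability (mxB R d) R).
Let F := {ffun 'I_t -> 'I_d * 'I_d}.
Local Notation G := (@grass R k d).

(* Set to zero off the Grassmannian, so that the bounds hold everywhere. *)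
Definition centred_feature (P : mxB R d) (f : F) : R :=
  (feature P f - feature_mean (k := k) sigma f) * \1_G P.

Lemma measurable_centred_feature f : measurable_fun setT (fun P => centred_feature P f).
Proof.
apply: measurable_funM; last by apply: measurable_indic; exact: measurable_grass.
by apply: measurable_funB; [exact: measurable_feature|exact: measurable_cst].
Qed.

Lemma centred_feature_grass P f : G P ->
  centred_feature P f = feature P f - feature_mean (k := k) sigma f.
Proof. by move=> GP; rewrite /centred_feature indicE mem_set// mulr1. Qed.

(** By the cubature property a feature has the same mean under [nu] as under [sigma], and [nu] gives
    the Grassmannian mass 1. *)
Lemma integral_centred_feature nu f : prob_cubature k t sigma nu ->
  (\int[nu]_P (centred_feature P f)%:E = 0)%E.
Proof.
move=> [nuG cub]; have mG := @measurable_grass R d k.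
transitivity (\int[nu]_(P in G) ((feature P f)%:E - (feature_mean (k := k) sigma f)%:E))%E.
  rewrite [RHS]integral_mkcond; apply: eq_integral => P _; rewrite patchE /centred_feature.
  by rewrite indicE; case: (P \in G); rewrite ?mulr1 ?mulr0 ?EFinB.
rewrite integralB//; last 2 first.
- exact: feature_integrable.
- exact: finite_measure_integrable_cst.
rewrite (cub (feature^~ f) (polyfun_feature f)) feature_meanE integral_cst//.
set m := (feature_mean _ _)%:E; transitivity (m - m * 1)%E.
  by congr (_ - _ * _)%E; exact: nuG.
by rewrite mule1 subee.
Qed.

Hypotheses (kd : (k <= d)%N) (hsigma : orth_invariant_grass_measure k sigma).
Let lam := lambda_t k t sigma.
Let kt := (k%:R : R) ^+ t.

(** Both cross terms and the squared norm of the mean equal [lam], leaving [- lam - lam + lam]. *)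
Lemma centred_feature_dot P Q : G P -> G Q ->
  \sum_f centred_feature P f * centred_feature Q f = Kt t P Q - lam.
Proof.
move=> GP GQ; pose mu : F -> R := feature_mean (k := k) sigma.
rewrite -feature_dot_sym; last by case: GQ.
have E : \sum_f centred_feature P f * centred_feature Q f =
  \sum_(f : F) feature P f * feature Q f - \sum_f feature P f * mu f
  - \sum_f feature Q f * mu f + \sum_f mu f ^+ 2.
  rewrite -!sumrB -big_split /=; apply: eq_bigr => f _.
  by rewrite !centred_feature_grass// -/(mu f); ring.
by rewrite E !(feature_dot_mean (sigma := sigma))// -lambda_tE -/lam; ring.
Qed.

Lemma lambda_t_ge0 : 0 <= lam.
Proof. by rewrite /lam lambda_tE; exact: sumsq_ge0. Qed.

(** [kt - lam] is the squared norm of the centred feature vector at any point; a point exists since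
    [sigma] gives the Grassmannian mass 1. *)
Lemma lambda_t_le : lam <= kt.
Proof.
have [P GP] : G !=set0.
  apply/set0P; apply/eqP => G0; have [] := hsigma.
  by rewrite G0 measure0 => /esym/eqP; rewrite onee_eq0.
have := sumsq_ge0 (centred_feature P); under eq_bigr do rewrite expr2.
rewrite centred_feature_dot// subr_ge0 -feature_dot_sym; last by case: GP.
by under eq_bigr do rewrite -expr2; rewrite (feature_sqnorm GP).
Qed.

Lemma centred_feature_sqnorm P : \sum_f centred_feature P f ^+ 2 <= kt - lam.
Proof.
have [GP|nGP] := pselect (G P).
  under eq_bigr do rewrite expr2.
  rewrite centred_feature_dot// lerB// -feature_dot_sym; last by case: GP.
  by under eq_bigr do rewrite -expr2; rewrite (feature_sqnorm GP).
rewrite big1 ?subr_ge0 ?lambda_t_le// => f _.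
by rewrite /centred_feature indicE memNset// mulr0 expr0n.
Qed.

Lemma sqnorm_sum_centred_feature (n : nat) (P : 'I_n -> 'M[R]_d) : (forall i, G (P i)) ->
  \sum_f (\sum_(i < n) centred_feature (P i) f) ^+ 2 =
  \sum_(i < n) \sum_(j < n) Kt t (P i) (P j) - n%:R ^+ 2 * lam.
Proof.
move=> GP; transitivity (\sum_(i < n) \sum_(j < n) (Kt t (P i) (P j) - lam)).
  under eq_bigr do rewrite expr2 big_distrlr /=.
  rewrite exchange_big /=; apply: eq_bigr => i _; rewrite exchange_big /=.
  by apply: eq_bigr => j _; exact: centred_feature_dot.
under eq_bigr do rewrite sumrB sumr_const card_ord.
by rewrite sumrB sumr_const card_ord -mulrnA -[_ *+ (n * n)]mulr_natl natrM expr2.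
Qed.

End centred_feature.

(* The optimal exponent in the Chernoff bound is [L = s / (n rho + s / 3)]; with
   [b = L sqrt rho] the factor [expR b - b] is at most
   [expR (rho * (expR L - 1 - L))]. *)
Lemma bernstein_exponent (R : realType) (rho s : R) (n : nat) :
  0 <= rho <= 1 -> 0 < s -> exists2 L : R, 0 < L &
  expR (- (L * s)) * (expR (L * Num.sqrt rho) - L * Num.sqrt rho) ^+ n <=
  expR (- ((s ^+ 2 / 2) / (n%:R * rho + s / 3))).
Proof.
move=> /andP[r0 r1] s0; set D := n%:R * rho + s / 3.
have nr0 : 0 <= n%:R * rho by rewrite mulr_ge0.
have D0 : 0 < D by rewrite /D; lra.
set L := s / D; have L0 : 0 < L by rewrite divr_gt0.
have sE : s = L * D by rewrite divfK// gt_eqF.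
exists L => //; set b := L * Num.sqrt rho; set phi := expR L - 1 - L.
have sq1 : 0 <= Num.sqrt rho <= 1.
  by rewrite sqrtr_ge0 -[leRHS]sqrtr1 ler_wsqrtr.
(* The remainder bound at [y = sqrt rho], followed by [1 + x <= expR x]. *)
have hb : expR b - b <= expR (rho * phi).
  have := expR_remainder_scale (ltW L0) sq1; rewrite sqr_sqrtr// -/b -/phi.
  by have := expR_ge1Dx (rho * phi); lra.
have hb0 : 0 <= expR b - b by have := expR_ge1Dx b; lra.
have {}hb : (expR b - b) ^+ n <= expR (n%:R * (rho * phi)).
  by rewrite expRM_natl lerXn2r// nnegrE expR_ge0.
rewrite (le_trans (ler_wpM2l (expR_ge0 _) hb))// -expRD ler_expR.
have Dn0 : D != 0 by rewrite gt_eqF.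
(* The choice of [L] turns Bernstein's factor [1 - L / 3] into [n * rho / D], so [n * rho * phi] is
   at most half of [L * s]. *)
have h3 : 1 - L / 3 = n%:R * rho / D.
  have -> : n%:R * rho = D - s / 3 by rewrite /D addrK.
  by rewrite /L; field.
have hphi : n%:R * rho * phi <= L ^+ 2 * D / 2.
  have h := expR_bernstein (ltW L0).
  have : (1 - L / 3) * phi <= L ^+ 2 / 2 by rewrite /phi; lra.
  by rewrite h3 mulrAC ler_pdivrMr//; lra.
have -> : s ^+ 2 / 2 / D = L ^+ 2 * D / 2 by rewrite /L; field.
rewrite [X in L * X]sE; have -> : L * (L * D) = L ^+ 2 * D by ring.
rewrite mulrA; lra.
Qed.

(** Numerator and denominator are multiplied by [n], which gives the form of [bernstein_exponent] at
    [s = tau * sqrt n]. *)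
Lemma Psi_rescale (R : realType) (lam kt tau : R) (n : nat) : (0 < n)%N ->
  Psi lam kt tau n =
  ((tau * Num.sqrt n%:R) ^+ 2 / 2) / (n%:R * (1 - lam / kt) + tau * Num.sqrt n%:R / 3).
Proof.
move=> n0; rewrite /Psi; set r := Num.sqrt _; set rho := 1 - _.
have r0 : r != 0 by rewrite gt_eqF// sqrtr_gt0 ltr0n.
have -> : (n%:R : R) = r ^+ 2 by rewrite sqr_sqrtr.
have -> : r ^+ 2 * rho + tau * r / 3 = r ^+ 2 * (rho + tau / (3 * r)) by field.
move: (rho + _) => D; rewrite exprMn [in RHS]invfM; move: D^-1 => e; by field.
Qed.

(** The added fraction is nonnegative, also when its denominator is 0, where the quotient is 0 by
    convention. *)
Lemma rfun_ge1 (R : realType) (lam kt tau : R) (n : nat) : 1 <= rfun lam kt tau n.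
Proof. rewrite /rfun lerDl; apply: divr_ge0 => //.
by apply: mulr_ge0 (sqr_ge0 _); apply: mulr_ge0 (sqr_ge0 _). Qed.

(** * The deviation bound for random projections *)

Theorem theorem5p3 (R : realType) (k d t n : nat)
  (hk1 : (1 <= k)%N) (hkd : (k < d)%N) (hn : (1 <= n)%N)
  (sigma : probability (mxB R d) R)
  (hsigma : orth_invariant_grass_measure k sigma)
  (nu : probability (mxB R d) R)
  (hnu : prob_cubature k t sigma nu)
  (dO : measure_display) (O : measurableType dO) (PP : probability O R)
  (X : 'I_n -> O -> mxB R d)
  (hlaw : forall i, has_law PP (X i) nu)
  (hind : mutually_independent PP X)
  (tau : R) (htau : 0 < tau) :
  let lam := lambda_t k t sigma in
  let kt := (k%:R : R) ^+ t in
  (PP [set w | (tau ^+ 2 * kt / n%:R <=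
               (n%:R ^+ 2)^-1 * (\sum_(i < n) \sum_(j < n) Kt t (X i w) (X j w))
               - lam - n%:R^-1 * (kt - lam))%R]
   <= (4 * expR (- Psi lam kt tau n) * rfun lam kt tau n)%:E)%E.
Proof.
cbv zeta; set lam := lambda_t _ _ _; set kt := (k%:R ^+ t : R); have kd : (k <= d)%N by exact: ltnW.
have mG := @measurable_grass R d k.
have kt0 : 0 < kt by rewrite exprn_gt0// ltr0n.
have lam0 : 0 <= lam by exact: lambda_t_ge0.
have lamk : lam <= kt by exact: lambda_t_le.
have n0 : 0 < (n%:R : R) by rewrite ltr0n.
set rho := 1 - lam / kt; set s := tau * Num.sqrt n%:R.
have rho01 : 0 <= rho <= 1.
  by rewrite subr_ge0 ler_pdivrMr// mul1r lamk gerBl divr_ge0// ltW.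
have s0 : 0 < s by rewrite mulr_gt0// sqrtr_gt0.
have [L L0 hL] := bernstein_exponent n rho01 s0.
(* This scale makes [L * sqrt rho] a bound for the norm of [xi], as in [bernstein_exponent]. *)
pose a := L / Num.sqrt kt.
have a0 : 0 <= a by rewrite divr_ge0 ?sqrtr_ge0// ltW.
have a2 : a ^+ 2 = L ^+ 2 / kt by rewrite expr_div_n sqr_sqrtr// ltW.
clearbody a.
pose xi P f := a * centred_feature (k := k) (t := t) sigma P f.
have b0 : 0 <= L * Num.sqrt rho by rewrite mulr_ge0 ?sqrtr_ge0// ltW.
have mxi f : measurable_fun setT (fun P => xi P f).
  by apply: measurable_funM; [exact: measurable_cst|exact: measurable_centred_feature].
have xib P : \sum_f xi P f ^+ 2 <= (L * Num.sqrt rho) ^+ 2.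
  under eq_bigr do rewrite exprMn.
  rewrite -mulr_sumr exprMn sqr_sqrtr; last by case/andP: rho01.
  have -> : L ^+ 2 * rho = a ^+ 2 * (kt - lam) by rewrite a2 /rho; field; rewrite gt_eqF.
  by rewrite ler_wpM2l ?sqr_ge0//; exact: centred_feature_sqnorm.
have xi0 f : (\int[nu]_P (xi P f)%:E = 0)%E.
  have -> : (fun P => (xi P f)%:E) = fun P => (a%:E * (centred_feature (k := k) sigma P f)%:E)%E.
    by apply/funext => P; rewrite EFinM.
  rewrite integralZl// ?(integral_centred_feature _ hnu) ?mule0//.
  apply: (@centred_integrable _ _ _ _ nu (centred_feature (k := k) (t := t) sigma)
    (Num.sqrt (kt - lam)) (sqrtr_ge0 _)) => [g|P].
    exact: measurable_centred_feature.
  by rewrite sqr_sqrtr ?subr_ge0//; exact: centred_feature_sqnorm.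
have mX i : measurable_fun setT (X i) by case: (hlaw i).
have lawX i A : measurable A -> PP (X i @^-1` A) = nu A by case: (hlaw i) => _; exact.
pose B := [set w | (L * s <= enorm (fun f => \sum_(i < n) xi (X i w) f))%R].
have mB : measurable B by exact: measurable_enorm_tail.
have tail : (PP B <= (2 * expR (- (L * s)) *
    (expR (L * Num.sqrt rho) - L * Num.sqrt rho) ^+ n)%:E)%E.
  by apply: (enorm_sum_tail b0 mxi xib xi0 mX lawX hind); rewrite mulr_ge0// ltW.
(* [N] is the null event that some [X i] leaves the Grassmannian, where centred features no longer
   encode [Kt]. *)
pose N := ~` \bigcap_i (X i @^-1` @grass R k d).
have mXG i : measurable (X i @^-1` @grass R k d).
  by rewrite -[_ @^-1` _]setTI; exact: mX.
have mG' : measurable (\bigcap_i (X i @^-1` @grass R k d)).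
  by apply: fin_bigcap_measurable => // i _.
have mN : measurable N by exact: measurableC.
have PN : PP N = 0%E.
  rewrite probability_setC// hind// big1 ?subee// => i _.
  by rewrite lawX//; case: hnu.
set E := [set w | _].
have mE : measurable E.
  have mK i j : measurable_fun setT (fun w => Kt t (X i w) (X j w)).
    apply: measurable_funX; apply: measurable_sum => l; under eq_fun do rewrite mxE.
    apply: measurable_sum => m; apply: measurable_funM.
      exact: (measurableT_comp (measurable_entry l m)).
    exact: (measurableT_comp (measurable_entry m l)).
  rewrite /E -[X in measurable X]setTI; apply: measurable_fun_le => //.
  do 2!apply: measurable_funB => //; apply: measurable_funM => //.
  by do 2!apply: measurable_sum => ?.
have EBN : E `<=` B `|` N.
  move=> w /= Ew; have [wG|/existsNP[i wi]] := pselect (forall i, @grass R k d (X i w)); last first.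
    by right => /(_ i I).
  left; rewrite /B /=.
  rewrite -(@ler_pXn2r _ 2)// ?nnegrE ?enorm_ge0// ?mulr_ge0 ?(ltW L0) ?(ltW htau)//.
  rewrite sqr_enorm; under eq_bigr do rewrite -mulr_sumr exprMn.
  rewrite -mulr_sumr sqnorm_sum_centred_feature// a2 exprMn -mulrA ler_wpM2l ?sqr_ge0//.
  rewrite mulrC ler_pdivlMr// /s exprMn sqr_sqrtr ?ler0n//.
  move: Ew; rewrite -/lam -/kt; set K := \sum_i _.
  (* The diagonal excess [n * (kt - lam)] is nonnegative, so the event forces [K - n ^+ 2 * lam] to
     be at least [s ^+ 2 * kt]. *)
  have k1 : 0 <= n%:R * (kt - lam) by rewrite mulr_ge0// subr_ge0.
  move=> /(ler_wpM2l (sqr_ge0 (n%:R : R))).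
  have -> : n%:R ^+ 2 * (tau ^+ 2 * kt / n%:R) = tau ^+ 2 * n%:R * kt.
    by field; rewrite gt_eqF.
  have -> : n%:R ^+ 2 * ((n%:R ^+ 2)^-1 * K - lam - n%:R^-1 * (kt - lam)) =
    K - n%:R ^+ 2 * lam - n%:R * (kt - lam) by field; rewrite gt_eqF.
  by lra.
apply: (@le_trans _ _ (PP (B `|` N))).
  by apply: le_measure; rewrite ?inE//; exact: measurableU.
have U2 : (PP (B `|` N) <= PP B + PP N)%E by exact: measureU2.
rewrite PN adde0 in U2; apply: (le_trans U2); apply: (le_trans tail).
rewrite lee_fin.
rewrite -mulrA (le_trans (ler_wpM2l _ hL))// /rho -Psi_rescale//.
(* The factor 2 of the tail bound is at most 4, and [rfun] is at least 1. *)
have e0 := expR_ge0 (- Psi lam kt tau n).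
have r1 := rfun_ge1 lam kt tau n.
by rewrite (@le_trans _ _ (4 * expR (- Psi lam kt tau n)))//; [lra|rewrite ler_peMr// mulr_ge0].
Qed.
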